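(* A quaternionic Kähler NH-manifold $(M,H,G)$ of dimension $4n\ge 8$ is scalar flat ($\tau=0$) if and only if it is flat ($R=0$).
   Context: $M$ is a smooth manifold of dimension $4n$. An almost hypercomplex structure on $M$ is a triple $H=(J_1,J_2,J_3)$ of almost complex structures with $J_\alpha=J_\beta\circ J_\gamma=-J_\gamma\circ J_\beta$ and $J_\alpha^2=-I$ for all cyclic permutations $(\alpha,\beta,\gamma)$ of $(1,2,3)$. Put $\varepsilon_1=1$, $\varepsilon_2=\varepsilon_3=-1$. An NH-metric structure $G=(g,g_1,g_2,g_3)$ on $(M,H)$ consists of a pseudo-Riemannian metric $g$ of neutral signature $(2n,2n)$ with $g(x,y)=\varepsilon_\alpha g(J_\alpha x,J_\alpha y)$ for $\alpha=1,2,3$, together with $g_\alpha(x,y)=g(J_\alpha x,y)=-\varepsilon_\alpha g(x,J_\alpha y)$. $(M,H,G)$ is then an almost hypercomplex NH-manifold. Let $\nabla$ be the Levi-Civita connection of $g$. $(M,H,G)$ is a quaternionic Kähler NH-manifold if there are (local) 1-forms $\omega_1,\omega_2,\omega_3$ with $(\nabla_xJ_\alpha)y=\omega_\gamma(x)J_\beta y-\omega_\beta(x)J_\gamma y$ for all cyclic permutations $(\alpha,\beta,\gamma)$ of $(1,2,3)$. $R$ is the curvature tensor of $\nabla$: $R(x,y)z=[\nabla_x,\nabla_y]z-\nabla_{[x,y]}z$, $R(x,y,z,w)=g(R(x,y)z,w)$; the Ricci tensor is $\rho(y,z)=g^{ij}R(e_i,y,z,e_j)$ and the scalar curvature is $\tau=g^{ij}\rho(e_i,e_j)$.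 *)

(* Defs.v *)
From HB Require Import structures.
From mathcomp Require Import all_boot all_order all_algebra.
From mathcomp Require Import all_classical all_reals all_analysis.

Set Implicit Arguments.
Unset Strict Implicit.
Unset Printing Implicit Defensive.

Import Order.TTheory GRing.Theory Num.Theory.
Import numFieldNormedType.Exports.

Local Open Scope classical_set_scope.
Local Open Scope ring_scope.

(* Points and tangent vectors of the model space are columns 'cV[R]_m, so the
   matrix of a composite of endomorphisms is the product of the matrices. *)

Section SmoothFunctions.
Context {R : realType} {m : nat}.
Local Notation E := 'cV[R]_m.

Definition partial (i : 'I_m) (f : E -> R) : E -> R :=
  fun x => 'D_(delta_mx i 0 : E) f x.

(* [U] is meant to be open: values of [f] outside of [U] are irrelevant *)
Fixpoint Ck (k : nat) (U : set E) (f : E -> R) : Prop :=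
  match k with
  | 0%N => forall x, U x -> {for x, continuous f}
  | k'.+1 => (forall x, U x -> differentiable f x) /\
             (forall i, Ck k' U (partial i f))
  end.

Definition smooth (U : set E) (f : E -> R) : Prop := forall k, Ck k U f.

Definition smooth_mx p q (U : set E) (F : E -> 'M[R]_(p, q)) : Prop :=
  forall i j, smooth U (fun x => F x i j).

Definition Jac (phi : E -> E) (x : E) : 'M[R]_m :=
  \matrix_(i, j) partial j (fun y => phi y i 0) x.

End SmoothFunctions.

Record chart (R : realType) (m : nat) (M : topologicalType) := Chart {
  cdom : set M;
  cmap : M -> 'cV[R]_m;
  cinv : 'cV[R]_m -> M;
  cdom_open : open cdom;
  cimg_open : open (cmap @` cdom);
  cmapK : forall p, cdom p -> cinv (cmap p) = p;
  cmap_continuous : forall p, cdom p -> {for p, continuous cmap};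
  cinv_continuous : forall p, cdom p -> {for cmap p, continuous cinv} }.

Section Charts.
Context {R : realType} {m : nat} {M : topologicalType}.

Definition cimg (c : chart R m M) (U : set M) : set 'cV[R]_m :=
  cmap c @` (cdom c `&` U).

Definition transition (c d : chart R m M) : 'cV[R]_m -> 'cV[R]_m :=
  fun x => cmap d (cinv c x).

End Charts.

Record smooth_manifold (R : realType) (m : nat) := SmoothManifold {
  carrier :> topologicalType;
  carrier_hausdorff : hausdorff_space carrier;
  carrier_second_countable : @second_countable carrier;
  atlas : set (chart R m carrier);
  atlas_cover : forall p : carrier, exists2 c, atlas c & cdom c p;
  atlas_smooth : forall c d, atlas c -> atlas d ->
    smooth_mx (cimg c (cdom d)) (transition c d) }.

(* Tensor fields are given by their components in each chart of the atlas, as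
   functions of the coordinates of that chart, subject to the usual
   transformation laws.  Components are only meaningful on [cimg c setT]. *)

Section Tensors.
Context {R : realType} {m : nat} (M : smooth_manifold R m).
Local Notation E := 'cV[R]_m.
Local Notation chartM := (chart R m M).

Record tensor11 := Tensor11 {
  t11 :> chartM -> E -> 'M[R]_m;
  t11_smooth : forall c, atlas c -> smooth_mx (cimg c setT) (t11 c);
  t11_law : forall c d x, atlas c -> atlas d -> cimg c (cdom d) x ->
    Jac (transition c d) x *m t11 c x =
    t11 d (transition c d x) *m Jac (transition c d) x }.

Record tensor02 := Tensor02 {
  t02 :> chartM -> E -> 'M[R]_m;
  t02_smooth : forall c, atlas c -> smooth_mx (cimg c setT) (t02 c);
  t02_law : forall c d x, atlas c -> atlas d -> cimg c (cdom d) x ->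
    t02 c x = (Jac (transition c d) x)^T *m
              t02 d (transition c d x) *m Jac (transition c d) x }.

Record one_form (U : set M) := OneForm {
  t01 :> chartM -> E -> 'rV[R]_m;
  t01_smooth : forall c, atlas c -> smooth_mx (cimg c U) (t01 c);
  t01_law : forall c d x, atlas c -> atlas d -> cimg c (cdom d `&` U) x ->
    t01 c x = t01 d (transition c d x) *m Jac (transition c d) x }.

(* [conn c k i j] is the Christoffel symbol with upper index [k]: in the chart
   [c], the covariant derivative of the j-th coordinate field along the i-th
   one is the sum over k of [conn c k i j] times the k-th one. *)
Record connection := Connection {
  conn :> chartM -> 'I_m -> 'I_m -> 'I_m -> E -> R;
  conn_smooth : forall c k i j, atlas c -> smooth (cimg c setT) (conn c k i j);
  conn_law : forall c d l i j x, atlas c -> atlas d -> cimg c (cdom d) x ->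
    let phi := transition c d in
    \sum_k Jac phi x l k * conn c k i j x =
    \sum_p \sum_q conn d l p q (phi x) * Jac phi x p i * Jac phi x q j
    + partial i (partial j (fun y => phi y l 0)) x }.

End Tensors.

Definition bil (R : realType) (m : nat) (B : 'M[R]_m) (u v : 'cV[R]_m) : R :=
  (u^T *m B *m v) 0 0.

(* Vector fields on (an open part of) the domain of a chart, written in its
   coordinates. *)
Section VectorFields.
Context {R : realType} {m : nat} {M : smooth_manifold R m}.
Local Notation E := 'cV[R]_m.
Variable nabla : connection M.
Variable c : chart R m M.

Definition Lie_der (X : E -> E) (f : E -> R) : E -> R :=
  fun x => \sum_i X x i 0 * partial i f x.

Definition bracket (X Y : E -> E) : E -> E :=
  fun x => \col_k (Lie_der X (fun y => Y y k 0) x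
                   - Lie_der Y (fun y => X y k 0) x).

Definition cov (X Y : E -> E) : E -> E :=
  fun x => \col_k (Lie_der X (fun y => Y y k 0) x
    + \sum_i \sum_j nabla c k i j x * X x i 0 * Y x j 0).

Definition cov_endo (J : tensor11 M) (X Y : E -> E) : E -> E :=
  fun x => cov X (fun y => J c y *m Y y) x - J c x *m cov X Y x.

Definition curv (X Y Z : E -> E) : E -> E :=
  fun x => cov X (cov Y Z) x - cov Y (cov X Z) x - cov (bracket X Y) Z x.

Variable g : tensor02 M.

Definition curv4 (X Y Z W : E -> E) : E -> R :=
  fun x => bil (g c x) (curv X Y Z x) (W x).

Definition coord_field (i : 'I_m) : E -> E := fun _ => delta_mx i 0.

Definition Ricci (Y Z : E -> E) : E -> R :=
  fun x => \sum_i \sum_j invmx (g c x) i j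
             * curv4 (coord_field i) Y Z (coord_field j) x.

Definition scalar_curv : E -> R :=
  fun x => \sum_i \sum_j invmx (g c x) i j
             * Ricci (coord_field i) (coord_field j) x.

End VectorFields.

Section Metric.
Context {R : realType} {m : nat} {M : smooth_manifold R m}.
Local Notation E := 'cV[R]_m.

Definition has_signature (p q : nat) (B : 'M[R]_m) : Prop :=
  [/\ m = (p + q)%N, B^T = B &
      exists2 P : 'M[R]_m, P \in unitmx &
        P^T *m B *m P = diag_mx (\row_(i < m) if (i < p)%N then 1 else -1)].

Definition pseudo_Riemannian (p q : nat) (g : tensor02 M) : Prop :=
  forall c x, atlas c -> cimg c setT x -> has_signature p q (g c x).

Definition Levi_Civita (g : tensor02 M) (nabla : connection M) : Prop :=
  forall c x (X Y Z : E -> E), atlas c -> cimg c setT x ->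
    smooth_mx (cimg c setT) X -> smooth_mx (cimg c setT) Y ->
    smooth_mx (cimg c setT) Z ->
    cov nabla c X Y x - cov nabla c Y X x = bracket X Y x /\
    Lie_der X (fun y => bil (g c y) (Y y) (Z y)) x =
      bil (g c x) (cov nabla c X Y x) (Z x)
      + bil (g c x) (Y x) (cov nabla c X Z x).

Definition flat (nabla : connection M) : Prop :=
  forall c x (X Y Z : E -> E), atlas c -> cimg c setT x ->
    smooth_mx (cimg c setT) X -> smooth_mx (cimg c setT) Y ->
    smooth_mx (cimg c setT) Z ->
    curv nabla c X Y Z x = 0.

Definition scalar_flat (g : tensor02 M) (nabla : connection M) : Prop :=
  forall c x, atlas c -> cimg c setT x -> scalar_curv nabla c g x = 0.

End Metric.

(* The indices 1, 2, 3 are the elements 0, 1, 2 of 'Z_3, so that the cyclic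
   permutations of (1,2,3) are the triples (a, a + 1, a + 2). *)
Definition eps (R : realType) (a : 'Z_3) : R := if a == 0 then 1 else -1.

Record almost_hypercomplex (R : realType) (n : nat)
    (M : smooth_manifold R (4 * n)%N) := AlmostHypercomplex {
  hc :> 'Z_3 -> tensor11 M;
  hc_sqr : forall a c x, atlas c -> cimg c setT x ->
    hc a c x *m hc a c x = - 1%:M;
  hc_mul : forall a c x, atlas c -> cimg c setT x ->
    hc a c x = hc (a + 1) c x *m hc (a + 2) c x;
  hc_anti : forall a c x, atlas c -> cimg c setT x ->
    hc a c x = - (hc (a + 2) c x *m hc (a + 1) c x) }.

Record NH_metric (R : realType) (n : nat) (M : smooth_manifold R (4 * n)%N)
    (H : almost_hypercomplex M) := NHMetric {
  nh_g : tensor02 M;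
  nh_ga : 'Z_3 -> tensor02 M;
  nh_neutral : pseudo_Riemannian (2 * n)%N (2 * n)%N nh_g;
  nh_compat : forall a c x (u v : 'cV[R]_(4 * n)), atlas c -> cimg c setT x ->
    bil (nh_g c x) u v
      = eps R a * bil (nh_g c x) (H a c x *m u) (H a c x *m v);
  nh_gaE : forall a c x (u v : 'cV[R]_(4 * n)), atlas c -> cimg c setT x ->
    bil (nh_ga a c x) u v = bil (nh_g c x) (H a c x *m u) v /\
    bil (nh_ga a c x) u v = - eps R a * bil (nh_g c x) u (H a c x *m v) }.

Definition quaternionic_Kahler (R : realType) (n : nat)
    (M : smooth_manifold R (4 * n)%N) (H : almost_hypercomplex M)
    (nabla : connection M) : Prop :=
  forall p : M, exists U : set M, [/\ open U, U p &
    exists w : 'Z_3 -> one_form U,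
      forall a c x (X Y : 'cV[R]_(4 * n) -> 'cV[R]_(4 * n)),
        atlas c -> cimg c U x ->
        smooth_mx (cimg c U) X -> smooth_mx (cimg c U) Y ->
        cov_endo nabla c (H a) X Y x =
          (w (a + 2) c x *m X x) 0 0 *: (H (a + 1) c x *m Y x)
          - (w (a + 1) c x *m X x) 0 0 *: (H (a + 2) c x *m Y x)].

(* Main.v *)
Require Import Defs.
From mathcomp Require Import all_boot all_order all_algebra.
From mathcomp Require Import all_classical all_reals all_analysis.
From mathcomp Require Import ring lra.

Set Implicit Arguments.
Unset Strict Implicit.
Unset Printing Implicit Defensive.

Import Order.TTheory GRing.Theory Num.Theory.
Import numFieldNormedType.Exports.

Local Open Scope classical_set_scope.
Local Open Scope ring_scope.

(** Write I, J, K for the three structures, I being the Hermitian one.  J and K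
    are self-adjoint for the Norden metric g and I = J K is skew-adjoint.  The
    Levi-Civita connection preserves self-adjointness, so no multiple of I can
    occur in the covariant derivatives of J and K.  Hence only one connection
    form w survives: J and K are rotated into each other by w, and I is parallel.
    With Phi = dw the Ricci identity gives
      [R(x,y), J] = Phi(x,y) K   and   [R(x,y), K] = - Phi(x,y) J.

    The rest is algebra at one point.  The Bianchi identity and the pair symmetry
    of R determine the defect R(Jx,y) - J R(x,y) in terms of Phi
    ([twisted_curvature]).  Taking its trace against I gives, in dimension m and
    with t the trace of I phi, where phi represents Phi,
      (2 - m) Phi(Jx,y) + 2 Phi(x,Jy) = t g(Kx,y)
    ([twist_form_relation]), while the Ricci form of the Kaehler structure (g, I)
    gives m t = 4 tau ([scalar_curvature_twist_form]).  If tau = 0 then t = 0, and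
    the relation together with the one where x and y are exchanged forces
    Phi = 0, because m is neither 0 nor 4 ([twist_form_eq0]).

    Once Phi = 0 the defects vanish: R is J-linear and K-linear in each of its
    arguments.  Moving J and K out of R(Kx,Jy) in both orders and recalling that J
    and K anticommute shows R = 0 ([curvature_eq0_of_twist_form_eq0]).

    The analytic part expresses the curvature of vector fields in a chart by
    Christoffel matrices ([curvE]) and derives the symmetries of R from there; its
    main ingredient is the symmetry of second derivatives ([derive_commute]). *)

(** * Four-tensors with the symmetries of a curvature tensor *)
Section CurvatureLike.
Context {R : realFieldType} {V : Type}.
Variable r : V -> V -> V -> V -> R.
Hypothesis skew12 : forall x y z w, r y x z w = - r x y z w.
Hypothesis bianchi : forall x y z w, r x y z w + r y z x w + r z x y w = 0.

(** Milnor's octahedron: a signed sum of the four instances of the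
    Bianchi identity obtained by cycling x, y, z, w. *)
Lemma curvature_pair_symmetry :
  (forall x y z w, r x y w z = - r x y z w) ->
  forall x y z w, r x y z w = r z w x y.
Proof.
move=> skew34 x y z w.
have := bianchi x y z w; have := bianchi y z w x.
have := bianchi z w x y; have := bianchi w x y z.
rewrite (skew34 x y z w) (skew34 y z x w) (skew34 z w x y) (skew34 w x y z).
rewrite (skew34 x z y w) (skew12 z x) (skew34 w y x z) (skew12 y w); lra.
Qed.

(** Think of [h] as g(K., .), so that the hypothesis on [J] says
    [R(x,y), J] = Phi(x,y) K with J self-adjoint.  The left-hand side, half of
    which is called q(x,y,z,w) in the proof, measures how far R fails to be
    complex linear in its first argument.  Bianchi controls q under the exchange
    of y and z, pair symmetry controls it under the exchange of x and y; the two
    ways of writing the reversal (x,y,z) -> (z,y,x) as a product of three such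
    exchanges give -q on one side and +q on the other, which determines q. *)
Lemma twisted_curvature (J : V -> V) (h Phi : V -> V -> R) :
  (forall x y z w, r x y z w = r z w x y) ->
  (forall x y z w, r x y (J z) w - r x y z (J w) = Phi x y * h z w) ->
  forall x y z w,
  2 * (r (J x) y z w - r x y z (J w)) =
    h x z * Phi y w + h x y * Phi z w - h y z * Phi x w
    - Phi y z * h x w + Phi x y * h z w + Phi x z * h y w.
Proof.
move=> rS rJ x y z w.
pose q x y z w := r (J x) y z w - r x y z (J w).
have q23 a b c : q a b c w = q a c b w - Phi b c * h a w.
  rewrite /q; have := bianchi (J a) b c w; have := bianchi a b c (J w).
  have := rJ b c a w; rewrite (skew12 (J a) c) (skew12 a c); lra.
have q12 a b c : q a b c w + q b a c w = h a b * Phi c w.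
  rewrite /q (skew12 a b) (skew12 a (J b)) (rS (J a)) (rS a (J b)).
  by have := rJ c w a b; lra.
rewrite -[r _ _ _ _ - _]/(q x y z w).
have := q12 x y z; have := q23 y x z; have := q12 y z x.
have := q23 x y z; have := q12 x z y; have := q23 z x y.
by lra.
Qed.

End CurvatureLike.

(** * Bilinear forms given by matrices, traces and adjoints *)
Lemma trmx_add (S : zmodType) p q (A B : 'M[S]_(p, q)) : (A + B)^T = A^T + B^T.
Proof. exact: raddfD. Qed.

Lemma trmx_opp (S : zmodType) p q (A : 'M[S]_(p, q)) : (- A)^T = - A^T.
Proof. exact: raddfN. Qed.

Section BilinearForms.
Context {R : realType} {m : nat}.
Implicit Types (g A B : 'M[R]_m) (u v : 'cV[R]_m).

Lemma bilDl g u1 u2 v : bil g (u1 + u2) v = bil g u1 v + bil g u2 v.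
Proof. by rewrite /bil linearD /= !mulmxDl mxE. Qed.

Lemma bilNl g u v : bil g (- u) v = - bil g u v.
Proof. by rewrite /bil raddfN /= !mulNmx mxE. Qed.

Lemma bilZl g a u v : bil g (a *: u) v = a * bil g u v.
Proof. by rewrite /bil linearZ /= -!scalemxAl mxE. Qed.

Lemma bil_oppmx g u v : bil (- g) u v = - bil g u v.
Proof. by rewrite /bil mulmxN mulNmx mxE. Qed.

Lemma bil_addmx A B u v : bil (A + B) u v = bil A u v + bil B u v.
Proof. by rewrite /bil mulmxDr mulmxDl mxE. Qed.

Lemma bil_scalemx a A u v : bil (a *: A) u v = a * bil A u v.
Proof. by rewrite /bil -scalemxAr -scalemxAl mxE. Qed.

Lemma bil0l g v : bil g 0 v = 0.
Proof. by rewrite /bil trmx0 !mul0mx mxE. Qed.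

Lemma bilC g u v : bil g v u = bil g^T u v.
Proof.
rewrite /bil; have -> : v^T *m g *m u = (u^T *m g^T *m v)^T.
  by rewrite !trmx_mul !trmxK mulmxA.
by rewrite mxE.
Qed.

Lemma bil_mulmxl g A u v : bil g (A *m u) v = bil (A^T *m g) u v.
Proof. by rewrite /bil trmx_mul !mulmxA. Qed.

Lemma bil_mulmxr g A u v : bil g u (A *m v) = bil (g *m A) u v.
Proof. by rewrite /bil !mulmxA. Qed.

Lemma bil_delta g i j : bil g (delta_mx i 0) (delta_mx j 0) = g i j.
Proof. by rewrite /bil !trmx_delta -!rowE -!colE !mxE. Qed.

Lemma bil_mx_inj A B : (forall u v, bil A u v = bil B u v) -> A = B.
Proof. by move=> AB; apply/matrixP => i j; rewrite -!bil_delta. Qed.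

Lemma mulmx_col_inj A B : (forall u : 'cV[R]_m, A *m u = B *m u) -> A = B.
Proof.
move=> AB; apply/matrixP => i j.
by have /colP/(_ i) := AB (delta_mx j 0); rewrite -!colE !mxE.
Qed.

Lemma bil_unit_inj g u v : g \in unitmx ->
  (forall w, bil g w u = bil g w v) -> u = v.
Proof.
move=> gU uv; suff : g *m u = g *m v by move/(can_inj (mulKmx gU)).
apply/colP => i; have := uv (delta_mx i 0).
by rewrite /bil !trmx_delta -!mulmxA -!rowE !mxE.
Qed.

(** The rank-one endomorphism w |-> g(v, w) u. *)
Definition outer g u v : 'M[R]_m := u *m v^T *m g.

Lemma outerE g u v w : outer g u v *m w = bil g v w *: u.
Proof.
rewrite /outer -!mulmxA [v^T *m _]mx11_scalar mul_mx_scalar.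
by rewrite /bil mulmxA.
Qed.

Lemma mxtrace_mul_outer g A u v : \tr (A *m outer g u v) = bil g v (A *m u).
Proof.
rewrite /outer !mulmxA -[A *m u *m _ *m _]mulmxA mxtrace_mulC.
by rewrite trace_mx11 /bil !mulmxA.
Qed.

Lemma mxtraceN A : \tr (- A) = - \tr A.
Proof. exact: raddfN. Qed.

Lemma mxtraceB A B : \tr (A - B) = \tr A - \tr B.
Proof. exact: raddfB. Qed.

(** Conjugating by [A] changes the sign of [B] but not its trace. *)
Lemma mxtrace_anticommute A B :
  A *m A = - 1%:M -> A *m B = - (B *m A) -> \tr B = 0.
Proof.
move=> AA AB; have : \tr (A *m (A *m B)) = - \tr (A *m (A *m B)).
  rewrite {1}AB mulmxN mxtraceN (mxtrace_mulC A) [in RHS]mulmxA.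
  by rewrite [in RHS]mxtrace_mulC mulmxA.
by rewrite mulmxA AA mulNmx mul1mx mxtraceN; lra.
Qed.

(** Passing to the [g]-adjoint preserves traces, and maps A B to - B A. *)
Lemma mxtrace_mul_adjoint g A B : g \in unitmx ->
  A^T *m g = g *m A -> B^T *m g = - (g *m B) -> \tr (A *m B) = 0.
Proof.
move=> gU gA gB.
have gAE : invmx g *m A^T *m g = A by rewrite -mulmxA gA mulKmx.
have E : \tr (invmx g *m A^T *m g *m B) = - \tr (A^T *m B^T).
  rewrite -mulmxA -[g *m B]opprK -gB mulmxN mxtraceN mxtrace_mulC.
  by rewrite -mulmxA mulKVmx // (mxtrace_mulC B^T).
have trAB : \tr (A^T *m B^T) = \tr (A *m B).
  by rewrite -trmx_mul mxtrace_tr mxtrace_mulC.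
by rewrite gAE trAB in E; lra.
Qed.

End BilinearForms.

(** * Algebraic curvature tensors with a quaternionic structure *)
Section MetricCurvature.
Context {R : realType} {m : nat}.
Variables (g : 'M[R]_m) (Rm : 'cV[R]_m -> 'cV[R]_m -> 'M[R]_m).
Implicit Types x y z w : 'cV[R]_m.
Hypotheses (gT : g^T = g) (gU : g \in unitmx).
Hypothesis RmC : forall x y, Rm y x = - Rm x y.
Hypothesis Rm_bianchi : forall x y z,
  Rm x y *m z + Rm y z *m x + Rm z x *m y = 0.
Hypothesis RmT : forall x y, (Rm x y)^T *m g = - (g *m Rm x y).

Local Notation r x y z w := (bil g (Rm x y *m z) w).

Let bilS x y : bil g x y = bil g y x.
Proof. by rewrite bilC gT. Qed.

Let rC12 x y z w : r y x z w = - r x y z w.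
Proof. by rewrite RmC mulNmx bilNl. Qed.

Let rC34 x y z w : r x y w z = - r x y z w.
Proof. by rewrite bilS bil_mulmxr bil_mulmxl RmT bil_oppmx opprK. Qed.

Let r_bianchi x y z w : r x y z w + r y z x w + r z x y w = 0.
Proof.
by rewrite -!bilDl Rm_bianchi -[0 in LHS](scale0r 0) bilZl mul0r.
Qed.

Let rS := curvature_pair_symmetry rC12 r_bianchi rC34.

(** The matrix form of [twisted_curvature]: nondegeneracy of [g] removes the
    arguments z and w, which makes the identity available for taking traces. *)
Lemma twisted_curvature_mx (J K phi : 'M[R]_m) :
  J^T *m g = g *m J ->
  (forall x y, Rm x y *m J - J *m Rm x y = bil g (phi *m x) y *: K) ->
  forall x y,
  2 *: (Rm (J *m x) y - J *m Rm x y) =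
    outer g (phi *m y) (K *m x) + bil g (K *m x) y *: phi
    - outer g (phi *m x) (K *m y) - outer g (K *m x) (phi *m y)
    + bil g (phi *m x) y *: K + outer g (K *m y) (phi *m x).
Proof.
move=> JT RmJ x y.
have rJ a b z w : r a b (J *m z) w - r a b z (J *m w) = bil g (phi *m a) b * bil g (K *m z) w.
  rewrite -bilZl scalemxAl -RmJ mulmxBl bilDl bilNl -!mulmxA.
  by congr (_ - _); rewrite bil_mulmxr -JT -bil_mulmxl.
have := @twisted_curvature _ _ _ rC12 r_bianchi (mulmx J) (fun a b => bil g (K *m a) b)
   (fun a b => bil g (phi *m a) b) rS rJ.
move=> H.
pose D := 2 *: (Rm (J *m x) y - J *m Rm x y).
rewrite -/D.
suff E z : D *m z = (outer g (phi *m y) (K *m x) + bil g (K *m x) y *: phi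
    - outer g (phi *m x) (K *m y) - outer g (K *m x) (phi *m y)
    + bil g (phi *m x) y *: K + outer g (K *m y) (phi *m x)) *m z.
  exact: mulmx_col_inj.
apply: (bil_unit_inj gU) => w.
rewrite bilS (bilS w) /D !mulmxDl !mulNmx !outerE -!scalemxAl mulmxBl.
rewrite -mulmxA !(bilDl, bilNl, bilZl).
have -> : bil g (J *m (Rm x y *m z)) w = r x y z (J *m w).
  by rewrite [RHS]bil_mulmxr -JT -bil_mulmxl.
rewrite H; ring.
Qed.

End MetricCurvature.

(** Here [g] is the metric at a point, [Rm x y] the curvature endomorphism, J and
    K are the two structures that are self-adjoint for [g], and I = J K is the
    skew-adjoint one.  [Phi] is the curvature of the connection form that rotates
    J into K, and [phi] is the endomorphism representing it. *)
Section QuaternionicCurvature.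
Context {R : realType} {m : nat}.
Variables (g I J K : 'M[R]_m) (Rm : 'cV[R]_m -> 'cV[R]_m -> 'M[R]_m).
Implicit Types x y z w : 'cV[R]_m.
Hypotheses (gT : g^T = g) (gU : g \in unitmx).
Hypotheses (JT : J^T *m g = g *m J) (KT : K^T *m g = g *m K).
Hypotheses (JJ : J *m J = - 1%:M) (KK : K *m K = - 1%:M).
Hypotheses (IE : I = J *m K) (KJ : K *m J = - (J *m K)).
Hypothesis RmC : forall x y, Rm y x = - Rm x y.
Hypothesis Rm_bianchi : forall x y z,
  Rm x y *m z + Rm y z *m x + Rm z x *m y = 0.
Hypothesis RmT : forall x y, (Rm x y)^T *m g = - (g *m Rm x y).
Variable phi : 'M[R]_m.
Hypothesis phiT : phi^T *m g = - (g *m phi).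
Local Notation Phi x y := (bil g (phi *m x) y).
Hypothesis RmJ : forall x y, Rm x y *m J - J *m Rm x y = Phi x y *: K.
Hypothesis RmK : forall x y, Rm x y *m K - K *m Rm x y = - Phi x y *: J.

Let bilS x y : bil g x y = bil g y x.
Proof. by rewrite bilC gT. Qed.

Let PhiS x y : Phi y x = - Phi x y.
Proof. by rewrite bilS bil_mulmxr bil_mulmxl phiT bil_oppmx opprK. Qed.

Let IK : I *m K = - J.
Proof. by rewrite IE -mulmxA KK mulmxN mulmx1. Qed.

Let IJ : I *m J = K.
Proof. by rewrite IE -mulmxA KJ mulmxN mulmxA JJ mulNmx opprK mul1mx. Qed.

Let KI : K *m I = J.
Proof. by rewrite IE mulmxA KJ mulNmx -mulmxA KK mulmxN opprK mulmx1. Qed.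

Let II : I *m I = - 1%:M.
Proof. by rewrite {1}IE -mulmxA KI JJ. Qed.

(** The part of R(x,y) that commutes with J and K does not contribute to this
    trace; the remaining one is a multiple of I. *)
Lemma mxtrace_Kahler_curvature x y :
  2 * \tr (I *m Rm x y) = - (m%:R * Phi x y).
Proof.
have := congr1 (fun A => \tr (A *m K)) (RmJ x y); rewrite /=.
rewrite mulmxBl -scalemxAl KK mxtraceB mxtraceZ mxtraceN mxtrace1.
have -> : \tr (Rm x y *m J *m K) = \tr (I *m Rm x y).
  by rewrite -mulmxA mxtrace_mulC IE.
have -> : \tr (J *m Rm x y *m K) = - \tr (I *m Rm x y).
  by rewrite mxtrace_mulC mulmxA KJ -IE mulNmx mxtraceN.
lra.
Qed.

(** Trace of [twisted_curvature_mx] against I.  Since I J = K is self-adjoint and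
    R(x,y) skew-adjoint, the second term on the left has trace zero, and every
    other trace is expressible by [Phi] alone. *)
Lemma twist_form_relation x y :
  (2 - m%:R) * Phi (J *m x) y + 2 * Phi x (J *m y)
  = \tr (I *m phi) * bil g (K *m x) y.
Proof.
have trKR : \tr (K *m Rm x y) = 0 by exact: (mxtrace_mul_adjoint gU KT).
have trJ : \tr J = 0.
  by apply: (mxtrace_anticommute KK); rewrite KJ.
have KI' u v : bil g (K *m u) (I *m v) = bil g (J *m u) v.
  by rewrite bil_mulmxl KT bil_mulmxr -mulmxA KI -JT -bil_mulmxl.
have := congr1 (fun A => \tr (I *m A))
  (twisted_curvature_mx gT gU RmC Rm_bianchi RmT JT RmJ x y); rewrite /=.
rewrite !(mulmxDr, mulmxN) -!scalemxAr mulmxDr mulmxN (mulmxA I J) IJ.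
rewrite mxtraceZ !(mxtraceD, mxtraceN) !mxtraceZ trKR IK.
rewrite mxtraceN trJ mulrBr mxtrace_Kahler_curvature.
rewrite !mxtrace_mul_outer !(mulmxA I K) IK !KI' !mulNmx.
rewrite !(bilS _ (- _)) !bilNl !(bilS (J *m _)) (PhiS _ (J *m x)).
by lra.
Qed.

(** Exchanging x and y in [twist_form_relation] gives two linear equations for
    Phi(Jx, y) and Phi(x, Jy), of determinant m (m - 4): this is where dimension
    4 has to be excluded. *)
Lemma twist_form_eq0 : m != 0%N -> m != 4 -> \tr (I *m phi) = 0 -> phi = 0.
Proof.
move=> m0 m4 t0.
have PJ x y : Phi (J *m x) y = 0.
  have := twist_form_relation x y; have := twist_form_relation y x.
  rewrite t0 !mul0r (PhiS x (J *m y)) (PhiS (J *m x) y).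
  set a := Phi (J *m x) y; set b := Phi x (J *m y) => E1 E2.
  (* elimination of b between E1 and E2 *)
  have : (m%:R : R) * (m%:R - 4) * a = 0.
    transitivity (- (m%:R - 2) * ((2 - m%:R) * a + 2 * b)
      + 2 * ((2 - m%:R) * - b + 2 * - a)); first by ring.
    by rewrite E1 E2 !mulr0 addr0.
  move/eqP; rewrite !mulf_eq0 pnatr_eq0 (negbTE m0) subr_eq0 eqr_nat (negbTE m4).
  by move/eqP.
apply: mulmx_col_inj => x; apply: (bil_unit_inj gU) => w.
have -> : x = J *m - (J *m x).
  by rewrite mulmxN mulmxA JJ mulNmx mul1mx opprK.
by rewrite mul0mx !(bilS w) bil0l PJ.
Qed.

(** With [phi = 0] the curvature is complex linear in each argument for both J
    and K.  Moving J and K out of R(Kx, Jy) in the two possible orders then gives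
    J K R(x,y) = K J R(x,y), whereas J and K anticommute. *)
Lemma curvature_eq0_of_twist_form_eq0 : phi = 0 -> forall x y, Rm x y = 0.
Proof.
move=> phi0.
have RJ x y : Rm (J *m x) y = J *m Rm x y.
  have := twisted_curvature_mx gT gU RmC Rm_bianchi RmT JT RmJ x y.
  rewrite phi0 /outer !mul0mx trmx0 !(mulmx0, mul0mx, bil0l) scaler0 scale0r.
  rewrite !(subr0, addr0) => /eqP; rewrite scaler_eq0 pnatr_eq0 /= subr_eq0.
  by move/eqP.
have RK x y : Rm (K *m x) y = K *m Rm x y.
  have RmK' a b : Rm a b *m K - K *m Rm a b = Phi a b *: - J.
    by rewrite RmK scaleNr scalerN.
  have := twisted_curvature_mx gT gU RmC Rm_bianchi RmT KT RmK' x y.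
  rewrite phi0 /outer !mul0mx trmx0 !(mulmx0, mul0mx, bil0l) scaler0 scale0r.
  rewrite !(subr0, addr0) => /eqP; rewrite scaler_eq0 pnatr_eq0 /= subr_eq0.
  by move/eqP.
have RJ' x y : Rm x (J *m y) = J *m Rm x y.
  by rewrite RmC RJ -mulmxN -RmC.
move=> x y.
have IR : I *m Rm x y = 0.
  have : J *m (K *m Rm x y) = K *m (J *m Rm x y) by rewrite -RK -RJ' RK RJ'.
  rewrite !mulmxA KJ -IE mulNmx => /eqP.
  by rewrite -addr_eq0 -mulr2n -(scaler_nat 2) scaler_eq0 pnatr_eq0 => /eqP.
by rewrite -[Rm x y]opprK -[Rm x y]mul1mx -mulNmx -II -mulmxA IR mulmx0 oppr0.
Qed.

Definition ricci_form y z : R := \sum_i (Rm (delta_mx i 0) y *m z) i 0.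

Hypothesis RmE : forall x y, Rm x y = \sum_i x i 0 *: Rm (delta_mx i 0) y.

Definition ricci_mx : 'M[R]_m :=
  \matrix_(k, j) \sum_i Rm (delta_mx i 0) (delta_mx k 0) i j.

Lemma ricci_formE y z : ricci_form y z = bil ricci_mx y z.
Proof.
have RmEr i : Rm (delta_mx i 0) y
    = \sum_k y k 0 *: Rm (delta_mx i 0) (delta_mx k 0).
  rewrite RmC RmE -sumrN; apply: eq_bigr => k _.
  by rewrite [in RHS]RmC scalerN.
rewrite /bil mxE /ricci_form.
under eq_bigr => i _ do rewrite mxE.
rewrite exchange_big /=; apply: eq_bigr => j _.
rewrite -mulr_suml mxE; congr (_ * _).
under eq_bigr => i _ do rewrite RmEr summxE.
rewrite exchange_big /=; apply: eq_bigr => k _.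
by rewrite !mxE mulr_sumr; apply: eq_bigr => i _; rewrite mxE.
Qed.

Let RI x y : Rm x y *m I = I *m Rm x y.
Proof.
have /eqP := RmJ x y; rewrite subr_eq => /eqP RJ.
have /eqP := RmK x y; rewrite subr_eq => /eqP RK.
rewrite IE mulmxA RJ mulmxDl -[J *m _ *m K]mulmxA RK mulmxDr -!scalemxAl.
rewrite -!scalemxAr KK JJ !scalerN scaleNr opprK mulmxA.
by rewrite addrA addNr add0r.
Qed.

(** The usual computation of the Ricci form of a Kaehler metric: Bianchi turns
    R(x,y)I into a difference of maps u |-> R(u,v)Iw, whose traces are Ricci
    curvatures because R commutes with I. *)
Lemma mxtrace_Kahler_curvature_ricci x y :
  \tr (I *m Rm x y) = ricci_form y (I *m x) - ricci_form x (I *m y).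
Proof.
(* S v w is the matrix of u |-> R(u,v)w, whose trace is the Ricci form *)
pose S y z : 'M[R]_m := \matrix_(a, i) (Rm (delta_mx i 0) y *m z) a 0.
have SE u v w : S v w *m u = Rm u v *m w.
  rewrite RmE mulmx_suml; apply/colP => a; rewrite mxE summxE.
  by apply: eq_bigr => i _; rewrite -scalemxAl !mxE mulrC.
have trS v w : \tr (S v w) = ricci_form v w.
  by apply: eq_bigr => i _; rewrite mxE.
have IS v w : I *m S v w = S v (I *m w).
  by apply: mulmx_col_inj => u; rewrite -mulmxA !SE !mulmxA RI.
have -> : I *m Rm x y = (S y x - S x y) *m I.
  apply: mulmx_col_inj => z; rewrite -RI -!mulmxA mulmxBl !SE.
  have /eqP := Rm_bianchi x y (I *m z).
  rewrite -addrA addr_eq0 => /eqP ->.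
  by rewrite (RmC (I *m z) y) mulNmx opprD opprK.
by rewrite mxtrace_mulC mulmxBr !IS mxtraceB !trS.
Qed.

(** Both [mxtrace_Kahler_curvature] and [mxtrace_Kahler_curvature_ricci] compute
    the trace of I R(x,y).  Contracting their comparison with I and using that I
    is an isometry, the two Ricci terms both contribute the scalar curvature. *)
Lemma scalar_curvature_twist_form :
  4 * (\sum_i \sum_j invmx g i j * ricci_form (delta_mx i 0) (delta_mx j 0))
  = m%:R * \tr (I *m phi).
Proof.
have IT : I^T *m g = - (g *m I).
  by rewrite IE trmx_mul -mulmxA JT mulmxA KT -mulmxA KJ mulmxN.
have scalE : \sum_i \sum_j invmx g i j * ricci_form (delta_mx i 0) (delta_mx j 0)
    = \tr (invmx g *m ricci_mx).
  have giT : (invmx g)^T = invmx g by rewrite trmx_inv gT.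
  rewrite /mxtrace exchange_big /=; apply: eq_bigr => j _; rewrite mxE.
  apply: eq_bigr => i _; rewrite -{1}giT mxE ricci_formE.
  by rewrite /bil trmx_delta -!rowE -colE !mxE.
have E : m%:R *: (g *m phi) = 2 *: (I^T *m ricci_mx^T - ricci_mx *m I).
  apply: bil_mx_inj => x y.
  rewrite !bil_scalemx bil_addmx bil_oppmx -(bil_mulmxr g) -(bil_mulmxr ricci_mx).
  rewrite -bil_mulmxl -(bilC ricci_mx) -!ricci_formE bilS PhiS mulrN.
  by rewrite -mxtrace_Kahler_curvature mxtrace_Kahler_curvature_ricci.
have := congr1 (fun A => \tr (I *m invmx g *m A)) E; rewrite /=.
have IgI : I *m invmx g *m I^T = invmx g.
  rewrite -[I^T](mulmxK gU) IT mulNmx mulmxN -mulmxA [invmx g *m _]mulmxA.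
  by rewrite mulKmx // mulmxA II mulNmx opprK mul1mx.
have giT : (invmx g)^T = invmx g by rewrite trmx_inv gT.
rewrite -!scalemxAr !mxtraceZ -[I *m _ *m (g *m _)]mulmxA mulKmx // => ->.
rewrite mulmxBr mxtraceB (mulmxA _ I^T) IgI.
have -> : \tr (I *m invmx g *m (ricci_mx *m I)) = - \tr (invmx g *m ricci_mx).
  rewrite mxtrace_mulC -mulmxA (mulmxA I I) II mulNmx mul1mx mulmxN mxtraceN.
  by rewrite mxtrace_mulC.
rewrite scalE.
have -> : \tr (invmx g *m ricci_mx^T) = \tr (invmx g *m ricci_mx).
  by rewrite -{1}giT -trmx_mul mxtrace_tr mxtrace_mulC.
by lra.
Qed.

Theorem curvature_eq0_of_scalar_eq0 : m != 0%N -> m != 4 ->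
  (\sum_i \sum_j invmx g i j * ricci_form (delta_mx i 0) (delta_mx j 0)) = 0 ->
  forall x y, Rm x y = 0.
Proof.
move=> m0 m4 t0; apply/curvature_eq0_of_twist_form_eq0/twist_form_eq0 => //.
have /esym/eqP := scalar_curvature_twist_form; rewrite t0 mulr0.
by rewrite mulf_eq0 pnatr_eq0 (negbTE m0) => /eqP.
Qed.

End QuaternionicCurvature.

(** * Symmetry of second derivatives *)
Section MixedDerivatives.
Context {R : realType} {V : normedModType R}.
Implicit Types (f : V -> R) (x u v : V).

Lemma is_derive_line f x v (t : R) : derivable f (x + t *: v) v ->
  is_derive t 1 (fun s : R => f (x + s *: v)) ('D_v f (x + t *: v)).
Proof.
move=> df.
have E : (fun h : R => h^-1 *: (((fun s : R => f (x + s *: v)) \o shift t) (h *: 1)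
      - f (x + t *: v))) =
  (fun h : R => h^-1 *: ((f \o shift (x + t *: v)) (h *: v) - f (x + t *: v))).
  apply/funext => h /=; congr (_ *: (f _ - _)).
  by rewrite [h *: 1]mulr1 scalerDl addrCA.
by split; rewrite /derivable /derive E.
Qed.

(** Mean value theorem in the direction [u] for the increment along h v, then in
    the direction [v] for the derivative along [u]. *)
Lemma second_difference f x u v (h : R) : 0 < h ->
  (forall s t, 0 <= s <= h -> 0 <= t <= h ->
    derivable f (x + s *: u + t *: v) u /\
    derivable ('D_u f) (x + s *: u + t *: v) v) ->
  exists s t, [/\ 0 <= s <= h, 0 <= t <= h &
    f (x + h *: u + h *: v) - f (x + h *: u) - (f (x + h *: v) - f x) =
    h ^+ 2 * 'D_v ('D_u f) (x + s *: u + t *: v)].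
Proof.
move=> h0 df.
have hh : 0 <= h <= h by rewrite ltW //= lexx.
have h00 : 0 <= (0 : R) <= h by rewrite lexx ltW.
pose G s := f (x + h *: v + s *: u) - f (x + s *: u).
pose dG s := 'D_u f (x + h *: v + s *: u) - 'D_u f (x + s *: u).
have GP s : 0 <= s <= h -> is_derive s 1 G (dG s).
  move=> sh; apply: is_deriveB; apply: is_derive_line.
    by rewrite addrAC; have [] := df _ _ sh hh.
  by have [] := df _ _ sh h00; rewrite scale0r addr0.
have [||s] := MVT_segment (ltW h0) (f := G) (df := dG).
- by move=> s; rewrite in_itv /= => /andP[/ltW s0 /ltW sh]; apply: GP; rewrite s0.
- apply: derivable_within_continuous => s; rewrite in_itv /= => sh.
  by have [] := GP _ sh.
rewrite in_itv /= => sh EG.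
pose dL t := 'D_v ('D_u f) (x + s *: u + t *: v).
have LP t : 0 <= t <= h ->
    is_derive t 1 (fun t => 'D_u f (x + s *: u + t *: v)) (dL t).
  by move=> th; apply: is_derive_line; have [] := df _ _ sh th.
have [||t] := MVT_segment (ltW h0) (f := fun t => 'D_u f (x + s *: u + t *: v)) (df := dL).
- by move=> t; rewrite in_itv /= => /andP[/ltW t0 /ltW th]; apply: LP; rewrite t0.
- apply: derivable_within_continuous => t; rewrite in_itv /= => th.
  by have [] := LP _ th.
rewrite in_itv /= => th EL.
exists s, t; split=> //.
move: EG; rewrite /G /dG scale0r !addr0 [x + h *: v + s *: u]addrAC.
rewrite scale0r addr0 in EL; rewrite EL subr0 [x + h *: v + h *: u]addrAC.
rewrite -/(dL t) => ->.
by rewrite -mulrA mulrC expr2.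
Qed.

(** The second difference over a small parallelogram is symmetric in [u] and
    [v]; by [second_difference] it equals h^2 times either mixed derivative at
    some nearby point, and both are continuous at x. *)
Lemma derive_commute (U : set V) f x u v : open U -> U x ->
  (forall y, U y -> derivable f y u /\ derivable f y v) ->
  (forall y, U y -> derivable ('D_u f) y v /\ derivable ('D_v f) y u) ->
  {for x, continuous ('D_v ('D_u f))} -> {for x, continuous ('D_u ('D_v f))} ->
  'D_v ('D_u f) x = 'D_u ('D_v f) x.
Proof.
move=> oU Ux df ddf cvu cuv.
set a := LHS; set b := RHS.
apply/eqP; rewrite -subr_eq0 -normr_le0; apply/ler_addgt0Pr => e e0; rewrite add0r.
have e2 : 0 < e / 2 by rewrite divr_gt0.
have [d /= d0 dP] : exists2 d : R, 0 < d & forall y, ball x d y -> [/\ U y,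
    `|a - 'D_v ('D_u f) y| < e / 2 & `|b - 'D_u ('D_v f) y| < e / 2].
  have /cvgrPdist_lt/(_ _ e2) C1 := cvu.
  have /cvgrPdist_lt/(_ _ e2) C2 := cuv.
  have : \forall y \near x, [/\ U y,
    `|a - 'D_v ('D_u f) y| < e / 2 & `|b - 'D_u ('D_v f) y| < e / 2].
    have C0 : nbhs x U by exact: open_nbhs_nbhs.
    apply: filterS3 C0 C1 C2 => y Uy A B; exact: (And3 Uy A B).
  by move=> /nbhs_ballP[d d0 dP]; exists d.
(* the parallelogram of side h at x then lies in the ball of radius d *)
pose h := d / (`|u| + `|v| + 1).
have N0 : 0 < `|u| + `|v| + 1 by rewrite ltr_wpDl// addr_ge0.
have h0 : 0 < h by rewrite divr_gt0.
have inball s t : 0 <= s <= h -> 0 <= t <= h -> ball x d (x + s *: u + t *: v).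
  move=> /andP[s0 sh] /andP[t0 th].
  rewrite -ball_normE /= -addrA opprD addNKr normrN.
  rewrite (le_lt_trans (ler_normD _ _))// !normrZ (ger0_norm s0) (ger0_norm t0).
  apply: (@le_lt_trans _ _ (h * (`|u| + `|v|))).
    by rewrite mulrDr lerD// ler_wpM2r.
  have -> : d = h * (`|u| + `|v| + 1) by rewrite /h divfK// gt_eqF.
  by rewrite ltr_pM2l// ltrDl.
have inball' t s : 0 <= t <= h -> 0 <= s <= h -> ball x d (x + t *: v + s *: u).
  by move=> th sh; rewrite addrAC; exact: inball.
have [|s [t [sh th E1]]] := @second_difference f x u v h h0.
  by move=> s t sh th; have [Uy _ _] := dP _ (inball _ _ sh th);
     have [? _] := df _ Uy; have [? _] := ddf _ Uy.
have [|t' [s' [th' sh' E2]]] := @second_difference f x v u h h0.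
  move=> t' s' th' sh'; have [Uy _ _] := dP _ (inball' _ _ th' sh').
  by have [_ ?] := df _ Uy; have [_ ?] := ddf _ Uy.
have [_ A _] := dP _ (inball _ _ sh th).
have [_ _ B] := dP _ (inball' _ _ th' sh').
move: A B E1 E2.
generalize ('D_v ('D_u f) (x + s *: u + t *: v)) => p.
generalize ('D_u ('D_v f) (x + t' *: v + s' *: u)) => q A B E1 E2.
have {E1 E2} pq : p = q.
  have hn0 : h ^+ 2 != 0 by rewrite expf_neq0// gt_eqF.
  apply: (mulfI hn0); rewrite -E1 -E2 [x + h *: v + h *: u]addrAC; ring.
rewrite pq in A.
have -> : a - b = (a - q) - (b - q) by ring.
rewrite (le_trans (ler_normB _ _))// (splitr e).
by apply: lerD; [exact: ltW A|exact: ltW B].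
Qed.

End MixedDerivatives.

(** * Entrywise calculus of matrix-valued functions *)
Section MatrixCalculus.
Context {R : realType} {m : nat}.
Local Notation E := 'cV[R]_m.

Definition dmx p q (i : 'I_m) (F : E -> 'M[R]_(p, q)) : E -> 'M[R]_(p, q) :=
  fun x => \matrix_(a, b) partial i (fun y => F y a b) x.

Definition differentiable_mx p q (F : E -> 'M[R]_(p, q)) (x : E) : Prop :=
  forall a b, differentiable (fun y => F y a b) x.

Lemma differentiable_mxD p q (F G : E -> 'M[R]_(p, q)) x :
  differentiable_mx F x -> differentiable_mx G x -> differentiable_mx (fun y => F y + G y) x.
Proof.
move=> dF dG a b.
have -> : (fun y => (F y + G y) a b) = (fun y => F y a b) \+ (fun y => G y a b).
  by apply/funext => y; rewrite mxE.
exact: differentiableD.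
Qed.

Lemma differentiable_mxN p q (F : E -> 'M[R]_(p, q)) x :
  differentiable_mx F x -> differentiable_mx (fun y => - F y) x.
Proof.
move=> dF a b.
have -> : (fun y => (- F y) a b) = - (fun y => F y a b).
  by apply/funext => y; rewrite mxE.
exact: differentiableN.
Qed.

Lemma differentiable_mxM p q s (F : E -> 'M[R]_(p, q)) (G : E -> 'M[R]_(q, s)) x :
  differentiable_mx F x -> differentiable_mx G x -> differentiable_mx (fun y => F y *m G y) x.
Proof.
move=> dF dG a b.
have -> : (fun y => (F y *m G y) a b) = \sum_k ((fun y => F y a k) * (fun y => G y k b)).
  by apply/funext => y; rewrite mxE fct_sumE.
by apply: differentiable_sum => k; exact: differentiableM.
Qed.

Lemma differentiable_mx_tr p q (F : E -> 'M[R]_(p, q)) x :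
  differentiable_mx F x -> differentiable_mx (fun y => (F y)^T) x.
Proof.
move=> dF a b.
have -> : (fun y => (F y)^T a b) = (fun y => F y b a).
  by apply/funext => y; rewrite mxE.
exact: dF.
Qed.

Lemma differentiable_mxZ p q (f : E -> R) (F : E -> 'M[R]_(p, q)) x :
  differentiable f x -> differentiable_mx F x -> differentiable_mx (fun y => f y *: F y) x.
Proof.
move=> df dF a b.
have -> : (fun y => (f y *: F y) a b) = f * (fun y => F y a b).
  by apply/funext => y; rewrite mxE.
exact: differentiableM.
Qed.

Lemma dmxD p q i (F G : E -> 'M[R]_(p, q)) x : differentiable_mx F x -> differentiable_mx G x ->
  dmx i (fun y => F y + G y) x = dmx i F x + dmx i G x.
Proof.
move=> dF dG; apply/matrixP => a b; rewrite !mxE /partial.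
rewrite -deriveD; [|exact: diff_derivable|exact: diff_derivable].
by congr ('D_ _ _ _); apply/funext => y; rewrite mxE.
Qed.

Lemma dmxN p q i (F : E -> 'M[R]_(p, q)) x : differentiable_mx F x ->
  dmx i (fun y => - F y) x = - dmx i F x.
Proof.
move=> dF; apply/matrixP => a b; rewrite !mxE /partial.
rewrite -deriveN; last exact: diff_derivable.
by congr ('D_ _ _ _); apply/funext => y; rewrite mxE.
Qed.

Lemma dmxM p q s i (F : E -> 'M[R]_(p, q)) (G : E -> 'M[R]_(q, s)) x :
  differentiable_mx F x -> differentiable_mx G x ->
  dmx i (fun y => F y *m G y) x = dmx i F x *m G x + F x *m dmx i G x.
Proof.
move=> dF dG; apply/matrixP => a b; rewrite !mxE /partial.
have -> : (fun y => (F y *m G y) a b) = \sum_k ((fun y => F y a k) * (fun y => G y k b)).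
  by apply/funext => y; rewrite mxE fct_sumE.
rewrite derive_sum; last first.
  by move=> k; apply: derivableM; exact: diff_derivable.
rewrite -big_split /=; apply: eq_bigr => k _.
rewrite deriveM; [|exact: diff_derivable|exact: diff_derivable].
by rewrite !mxE addrC /partial; congr (_ + _); rewrite [LHS]mulrC.
Qed.

Lemma dmxE p q i (F : E -> 'M[R]_(p, q)) x a b :
  dmx i F x a b = partial i (fun y => F y a b) x.
Proof. by rewrite mxE. Qed.

Lemma dmx_sum p q n i (F : 'I_n -> E -> 'M[R]_(p, q)) x :
  (forall k, differentiable_mx (F k) x) ->
  dmx i (fun y => \sum_k F k y) x = \sum_k dmx i (F k) x.
Proof.
move=> dF; apply/matrixP => a b; rewrite summxE dmxE /partial.
have -> : (fun y => (\sum_k F k y) a b) = \sum_k (fun y => F k y a b).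
  by apply/funext => y; rewrite summxE fct_sumE.
rewrite derive_sum; last by move=> k; apply: diff_derivable; exact: dF.
by apply: eq_bigr => k _; rewrite dmxE.
Qed.

Lemma dmx_tr p q i (F : E -> 'M[R]_(p, q)) x :
  dmx i (fun y => (F y)^T) x = (dmx i F x)^T.
Proof.
apply/matrixP => a b; rewrite !mxE /partial.
by congr ('D_ _ _ _); apply/funext => y; rewrite mxE.
Qed.

Lemma dmxZ p q i (f : E -> R) (F : E -> 'M[R]_(p, q)) x :
  differentiable f x -> differentiable_mx F x ->
  dmx i (fun y => f y *: F y) x = partial i f x *: F x + f x *: dmx i F x.
Proof.
move=> df dF; apply/matrixP => a b; rewrite !mxE /partial.
have -> : (fun y => (f y *: F y) a b) = f * (fun y => F y a b).
  by apply/funext => y; rewrite mxE.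
rewrite deriveM; [|exact: diff_derivable|exact: diff_derivable].
by rewrite addrC; congr (_ + _); rewrite [LHS]mulrC.
Qed.

Lemma partial_cst i (a : R) : partial i (fun _ : E => a) = fun _ => 0.
Proof. by apply/funext => x; exact: derive_cst. Qed.

Lemma dmx_cst p q i (A : 'M[R]_(p, q)) x : dmx i (fun _ => A) x = 0.
Proof. by apply/matrixP => a b; rewrite !mxE partial_cst. Qed.

Lemma dmx_eq_in p q i (U : set E) (F G : E -> 'M[R]_(p, q)) x :
  open U -> U x -> (forall y, U y -> F y = G y) -> dmx i F x = dmx i G x.
Proof.
move=> oU Ux FG; apply/matrixP => a b; rewrite !mxE /partial.
apply: near_eq_derive.
have : nbhs x U by exact: open_nbhs_nbhs.
by apply: filterS => y /FG ->.
Qed.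

Lemma smooth_partial (U : set E) i f : smooth U f -> smooth U (partial i f).
Proof. by move=> sf k; have [_ /(_ i)] := sf k.+1. Qed.

Lemma smooth_differentiable (U : set E) f x :
  smooth U f -> U x -> differentiable f x.
Proof. by move=> sf Ux; have [df _] := sf 1%N; exact: df. Qed.

Lemma smooth_cst (U : set E) (a : R) : smooth U (fun _ => a).
Proof.
move=> k; elim: k a => [|k IH] a /=; first by move=> x _; exact: cst_continuous.
split=> [x _|i]; first exact: differentiable_cst.
by rewrite partial_cst.
Qed.

Lemma smooth_sub (U W : set E) f : U `<=` W -> smooth W f -> smooth U f.
Proof.
move=> UW sf k; move: f {sf}(sf k); elim: k => [|k IH] f /=.
  by move=> cf x /UW; exact: cf.
by move=> [df cf]; split=> [x /UW|i]; [exact: df|exact: IH].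
Qed.

Lemma partial_commute (U : set E) i j f x : open U -> U x -> smooth U f ->
  partial i (partial j f) x = partial j (partial i f) x.
Proof.
move=> oU Ux sf; apply: (derive_commute oU Ux).
- by move=> y Uy; split; apply/diff_derivable/(smooth_differentiable sf).
- by move=> y Uy; split; apply/diff_derivable;
    apply: (smooth_differentiable _ Uy); exact: smooth_partial.
- by have [_ /(_ j)[_ /(_ i) cf]] := sf 2; exact: cf.
- by have [_ /(_ i)[_ /(_ j) cf]] := sf 2; exact: cf.
Qed.

Lemma smooth_mx_diff p q (U : set E) (F : E -> 'M[R]_(p, q)) x :
  smooth_mx U F -> U x -> differentiable_mx F x.
Proof. by move=> sF Ux a b; exact: smooth_differentiable (sF a b) Ux. Qed.

Lemma smooth_mx_cst p q (U : set E) (A : 'M[R]_(p, q)) : smooth_mx U (fun _ => A).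
Proof. by move=> a b; exact: smooth_cst. Qed.

Lemma smooth_mx_sub p q (U W : set E) (F : E -> 'M[R]_(p, q)) :
  U `<=` W -> smooth_mx W F -> smooth_mx U F.
Proof. by move=> UW sF a b; exact: smooth_sub UW (sF a b). Qed.

Lemma smooth_mx_dmx p q (U : set E) i (F : E -> 'M[R]_(p, q)) :
  smooth_mx U F -> smooth_mx U (dmx i F).
Proof.
move=> sF a b.
have -> : (fun x => dmx i F x a b) = partial i (fun x => F x a b).
  by apply/funext => x; rewrite mxE.
exact: smooth_partial.
Qed.

Lemma dmx_commute p q (U : set E) i j (F : E -> 'M[R]_(p, q)) x :
  open U -> U x -> smooth_mx U F -> dmx i (dmx j F) x = dmx j (dmx i F) x.
Proof.
move=> oU Ux sF; apply/matrixP => a b.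
have E k : (fun y => dmx k F y a b) = partial k (fun y => F y a b).
  by apply/funext => y; rewrite dmxE.
by rewrite [LHS]dmxE [RHS]dmxE (E i) (E j); exact: partial_commute (sF a b).
Qed.

End MatrixCalculus.

(** * Curvature of a connection given by matrices of Christoffel symbols *)

(** Expands products of matrices over sums and replaces each monomial by a
    variable, so that an identity holding by cancellation of monomials becomes
    one of an abelian group. *)
Ltac mx_linear :=
  rewrite ?(mulmxDl, mulmxDr, mulNmx, mulmxN, opprD, opprK, mulmxA);
  repeat match goal with |- context [@mulmx ?S ?p ?q ?s ?A ?B] =>
    let X := fresh in set X := (@mulmx _ p q s A B); clearbody X end.

Section LocalConnection.
Context {R : realType} {m : nat}.
Local Notation E := 'cV[R]_m.
Variables (U : set E) (Gam : 'I_m -> E -> 'M[R]_m).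
Hypotheses (oU : open U) (sGam : forall i, smooth_mx U (Gam i)).

Definition curv_mx (i j : 'I_m) (x : E) : 'M[R]_m :=
  dmx i (Gam j) x - dmx j (Gam i) x
  + Gam i x *m Gam j x - Gam j x *m Gam i x.

Lemma curv_mxC i j x : curv_mx j i x = - curv_mx i j x.
Proof. by rewrite /curv_mx; apply/matrixP => a b; rewrite !mxE; ring. Qed.

Let dGam i x : U x -> differentiable_mx (Gam i) x.
Proof. exact: smooth_mx_diff. Qed.

(** In [D i (D j Z) - D j (D i Z)] the second derivatives of Z cancel by symmetry
    and the first derivatives of Z occur symmetrically. *)
Lemma ricci_identity_vector i j (Z : E -> E) x : U x -> smooth_mx U Z ->
  let D k (W : E -> E) y := dmx k W y + Gam k y *m W y in
  D i (D j Z) x - D j (D i Z) x = curv_mx i j x *m Z x.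
Proof.
move=> Ux sZ D; rewrite /D.
have dZ := smooth_mx_diff sZ Ux.
have dGZ k l : dmx k (fun y => dmx l Z y + Gam l y *m Z y) x =
    dmx k (dmx l Z) x + (dmx k (Gam l) x *m Z x + Gam l x *m dmx k Z x).
  rewrite dmxD ?dmxM //; try exact: dGam.
    exact: smooth_mx_diff (smooth_mx_dmx _ sZ) Ux.
  by apply: differentiable_mxM => //; exact: dGam.
rewrite !dGZ (dmx_commute j i oU Ux sZ) /curv_mx.
move: (dmx i (Gam j) x) (dmx j (Gam i) x) (dmx i (dmx j Z) x) => a b c.
move: (dmx i Z x) (dmx j Z x) (Z x) (Gam i x) (Gam j x) => d e f g h.
by mx_linear; apply/matrixP => p q; rewrite !mxE; ring.
Qed.

Lemma ricci_identity_endo i j (A : E -> 'M[R]_m) (B : 'I_m -> E -> 'M[R]_m) x :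
  U x -> smooth_mx U A -> (forall k, differentiable_mx (B k) x) ->
  (forall k y, U y -> dmx k A y + Gam k y *m A y - A y *m Gam k y = B k y) ->
  curv_mx i j x *m A x - A x *m curv_mx i j x =
    (dmx i (B j) x + Gam i x *m B j x - B j x *m Gam i x)
    - (dmx j (B i) x + Gam j x *m B i x - B i x *m Gam j x).
Proof.
move=> Ux sA dB AB.
have dA := smooth_mx_diff sA Ux.
have ddA k l : dmx k (B l) x = dmx k (dmx l A) x
    + (dmx k (Gam l) x *m A x + Gam l x *m dmx k A x)
    - (dmx k A x *m Gam l x + A x *m dmx k (Gam l) x).
  have dG := dGam l Ux.
  have dGA : differentiable_mx (fun y => Gam l y *m A y) x by exact: differentiable_mxM.
  have dAG : differentiable_mx (fun y => A y *m Gam l y) x by exact: differentiable_mxM.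
  have ddA := smooth_mx_diff (smooth_mx_dmx l sA) Ux.
  rewrite -(dmx_eq_in k oU Ux (AB l)).
  rewrite dmxD; [|exact: differentiable_mxD|exact: differentiable_mxN].
  by rewrite dmxD // dmxN // !dmxM.
rewrite !ddA (dmx_commute j i oU Ux sA) -!AB // /curv_mx.
move: (dmx i (Gam j) x) (dmx j (Gam i) x) (dmx i (dmx j A) x) => a b c.
move: (dmx i A x) (dmx j A x) (A x) (Gam i x) (Gam j x) => d e f g h.
by mx_linear; apply/matrixP => p q; rewrite !mxE; ring.
Qed.

(** Differentiating the equation for [dmx k g] once more and using the symmetry
    of the second derivatives of g. *)
Lemma curv_mx_metric i j (g : E -> 'M[R]_m) x : U x -> smooth_mx U g ->
  (forall k y, U y -> dmx k g y = (Gam k y)^T *m g y + g y *m Gam k y) ->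
  (curv_mx i j x)^T *m g x = - (g x *m curv_mx i j x).
Proof.
move=> Ux sg gE.
have dg := smooth_mx_diff sg Ux.
have ddg k l : dmx k (dmx l g) x =
    ((dmx k (Gam l) x)^T *m g x + (Gam l x)^T *m dmx k g x)
    + (dmx k g x *m Gam l x + g x *m dmx k (Gam l) x).
  have dG := dGam l Ux; have dGT := differentiable_mx_tr dG.
  rewrite (dmx_eq_in k oU Ux (gE l)).
  rewrite dmxD; [|exact: differentiable_mxM|exact: differentiable_mxM].
  by rewrite !dmxM // dmx_tr.
have := dmx_commute i j oU Ux sg; rewrite !ddg !gE // /curv_mx.
rewrite !trmx_add !trmx_opp !trmx_mul.
move: (dmx i (Gam j) x) (dmx j (Gam i) x) (g x) (Gam i x) (Gam j x) => a b c d e.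
mx_linear => EE; apply/matrixP => p q.
by move/matrixP/(_ p q): EE; rewrite !mxE; lra.
Qed.

Lemma curv_mx_bianchi i j k x : U x ->
  (forall a b y, U y -> Gam a y *m delta_mx b 0 = Gam b y *m (delta_mx a 0 : E)) ->
  curv_mx i j x *m delta_mx k 0 + curv_mx j k x *m delta_mx i 0
  + curv_mx k i x *m delta_mx j 0 = 0 :> E.
Proof.
move=> Ux Gsym.
have dGsym a b c : dmx c (Gam a) x *m delta_mx b 0
    = dmx c (Gam b) x *m (delta_mx a 0 : E).
  have cst d : differentiable_mx (fun _ : E => delta_mx d 0 : E) x.
    exact: smooth_mx_diff (smooth_mx_cst U _) Ux.
  have := dmx_eq_in c oU Ux (Gsym a b).
  rewrite !dmxM //; try exact: dGam.
  by rewrite !dmx_cst !mulmx0 !addr0.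
rewrite /curv_mx !(mulmxDl, mulNmx) -!mulmxA.
have D1 := dGsym k j i; have D2 := dGsym k i j; have D3 := dGsym j i k.
have G1 := Gsym k j x Ux; have G2 := Gsym k i x Ux; have G3 := Gsym j i x Ux.
move: D1 D2 D3 G1 G2 G3.
move: (dmx i (Gam j) x) (dmx i (Gam k) x) (dmx j (Gam i) x) => a1 a2 a3.
move: (dmx j (Gam k) x) (dmx k (Gam i) x) (dmx k (Gam j) x) => a4 a5 a6.
move=> -> -> -> -> -> ->.
by mx_linear; apply/matrixP => p q; rewrite !mxE; ring.
Qed.

(** For a parallel metric, the covariant derivative of a self-adjoint field of
    endomorphisms is self-adjoint. *)
Lemma cov_self_adjoint i (g A : E -> 'M[R]_m) (B : 'M[R]_m) x : U x ->
  smooth_mx U g -> smooth_mx U A ->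
  dmx i g x = (Gam i x)^T *m g x + g x *m Gam i x ->
  dmx i A x + Gam i x *m A x - A x *m Gam i x = B ->
  (forall y, U y -> (A y)^T *m g y = g y *m A y) ->
  B^T *m g x = g x *m B.
Proof.
move=> Ux sg sA gE <- gA.
have dg := smooth_mx_diff sg Ux; have dA := smooth_mx_diff sA Ux.
have := dmx_eq_in i oU Ux gA; rewrite !dmxM //; last exact: differentiable_mx_tr.
rewrite dmx_tr gE !trmx_add !trmx_opp !trmx_mul.
have gAx := gA x Ux.
have := congr1 (mulmx^~ (Gam i x)) gAx; have := congr1 (mulmx (Gam i x)^T) gAx.
rewrite /=; move: (dmx i A x) (g x) (A x) (Gam i x) => a b c d.
mx_linear => E1 E2 E3; apply/matrixP => p q.
move/matrixP/(_ p q): E1; move/matrixP/(_ p q): E2; move/matrixP/(_ p q): E3.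
by rewrite !mxE; lra.
Qed.

(** If J and K span a parallel plane bundle in which the connection acts by
    infinitesimal rotations, then the curvature acts on it through the exterior
    derivative of the rotation form: the quadratic terms w_i w_j cancel. *)
Lemma curv_mx_rotation i j (J K : E -> 'M[R]_m) (w : 'I_m -> E -> R) x :
  U x -> smooth_mx U J -> differentiable_mx K x ->
  (forall k, differentiable (w k) x) ->
  (forall k y, U y ->
    dmx k J y + Gam k y *m J y - J y *m Gam k y = w k y *: K y) ->
  (forall k y, U y ->
    dmx k K y + Gam k y *m K y - K y *m Gam k y = - (w k y *: J y)) ->
  curv_mx i j x *m J x - J x *m curv_mx i j x =
    (partial i (w j) x - partial j (w i) x) *: K x.
Proof.
move=> Ux sJ dK dw DJ DK.
have dwK k : differentiable_mx (fun y => w k y *: K y) x.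
  exact: differentiable_mxZ.
rewrite (ricci_identity_endo i j Ux sJ dwK DJ) !dmxZ //.
have dKE k : dmx k K x = - (w k x *: J x) - Gam k x *m K x + K x *m Gam k x.
  by rewrite -DK //; apply/matrixP => p q; rewrite !mxE; ring.
rewrite !dKE -!(scalemxAl, scalemxAr).
move: (Gam i x *m K x) (Gam j x *m K x) (K x *m Gam i x) (K x *m Gam j x).
by move=> a b c d; apply/matrixP => p q; rewrite !mxE; ring.
Qed.

End LocalConnection.

(** * From curvature components to curvature endomorphisms *)
Section BilinearExtension.
Context {R : realType} {m : nat}.
Local Notation E := 'cV[R]_m.
Variable Rc : 'I_m -> 'I_m -> 'M[R]_m.

Definition bilinear_ext (x y : E) : 'M[R]_m :=
  \sum_i \sum_j (x i 0 * y j 0) *: Rc i j.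

Lemma bilinear_extE x y :
  bilinear_ext x y = \sum_i x i 0 *: bilinear_ext (delta_mx i 0) y.
Proof.
rewrite /bilinear_ext; apply: eq_bigr => i _; rewrite [in RHS](bigD1 i) //=.
rewrite [X in _ + X]big1 => [|k ki].
  rewrite addr0 scaler_sumr; apply: eq_bigr => j _.
  by rewrite mxE !eqxx mul1r scalerA.
by apply: big1 => j _; rewrite mxE (negbTE ki) mul0r scale0r.
Qed.

Lemma bilinear_extC : (forall i j, Rc j i = - Rc i j) ->
  forall x y, bilinear_ext y x = - bilinear_ext x y.
Proof.
move=> RC x y; rewrite /bilinear_ext exchange_big /= -sumrN.
apply: eq_bigr => i _; rewrite -sumrN; apply: eq_bigr => j _.
by rewrite RC scalerN mulrC.
Qed.

Lemma bilinear_ext_mul x y z : bilinear_ext x y *m z =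
  \sum_i \sum_j \sum_k (x i 0 * y j 0 * z k 0) *: (Rc i j *m (delta_mx k 0 : E)).
Proof.
rewrite /bilinear_ext mulmx_suml; apply: eq_bigr => i _.
rewrite mulmx_suml; apply: eq_bigr => j _.
have {1}-> : z = \sum_k z k 0 *: delta_mx k 0.
  rewrite {1}[z]matrix_sum_delta; apply: eq_bigr => k _.
  by rewrite big_ord_recl big_ord0 addr0.
rewrite mulmx_sumr; apply: eq_bigr => k _.
by rewrite -scalemxAl -scalemxAr scalerA.
Qed.

Lemma bilinear_ext_bianchi :
  (forall i j k, Rc i j *m delta_mx k 0 + Rc j k *m delta_mx i 0
    + Rc k i *m delta_mx j 0 = 0 :> E) ->
  forall x y z, bilinear_ext x y *m z + bilinear_ext y z *m x
    + bilinear_ext z x *m y = 0.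
Proof.
move=> RB x y z; rewrite !bilinear_ext_mul.
(* rename the summation indices so that all sums carry x_i y_j z_k *)
have -> : \sum_i \sum_j \sum_k (y i 0 * z j 0 * x k 0) *: (Rc i j *m delta_mx k 0)
    = \sum_i \sum_j \sum_k (x i 0 * y j 0 * z k 0) *: (Rc j k *m delta_mx i 0) :> E.
  rewrite [RHS]exchange_big /=; apply: eq_bigr => j _.
  rewrite [RHS]exchange_big /=; apply: eq_bigr => k _; apply: eq_bigr => i _.
  by congr (_ *: _); ring.
have -> : \sum_i \sum_j \sum_k (z i 0 * x j 0 * y k 0) *: (Rc i j *m delta_mx k 0)
    = \sum_i \sum_j \sum_k (x i 0 * y j 0 * z k 0) *: (Rc k i *m delta_mx j 0) :> E.
  rewrite exchange_big /=; apply: eq_bigr => i _.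
  rewrite exchange_big /=; apply: eq_bigr => j _; apply: eq_bigr => k _.
  by congr (_ *: _); ring.
rewrite -!big_split /=; apply: big1 => i _.
rewrite -!big_split /=; apply: big1 => j _.
rewrite -!big_split /=; apply: big1 => k _.
by rewrite -!scalerDr RB scaler0.
Qed.

Lemma bilinear_ext_skew (g : 'M[R]_m) :
  (forall i j, (Rc i j)^T *m g = - (g *m Rc i j)) ->
  forall x y, (bilinear_ext x y)^T *m g = - (g *m bilinear_ext x y).
Proof.
move=> RT x y; rewrite /bilinear_ext raddf_sum mulmx_suml mulmx_sumr -sumrN.
apply: eq_bigr => i _; rewrite raddf_sum mulmx_suml mulmx_sumr -sumrN.
apply: eq_bigr => j _.
by rewrite /= linearZ /= -scalemxAl RT scalerN -scalemxAr.
Qed.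

Lemma bilinear_ext_commutator (J K F : 'M[R]_m) :
  (forall i j, Rc i j *m J - J *m Rc i j = F i j *: K) ->
  forall x y, bilinear_ext x y *m J - J *m bilinear_ext x y = bil F x y *: K.
Proof.
move=> RJ x y; rewrite /bilinear_ext /bil.
rewrite mulmx_suml mulmx_sumr -sumrB mxE.
under [in RHS]eq_bigr => j _ do rewrite mxE mulr_suml.
rewrite exchange_big /= scaler_suml; apply: eq_bigr => i _.
rewrite mulmx_suml mulmx_sumr -sumrB scaler_suml; apply: eq_bigr => j _.
rewrite -scalemxAl -scalemxAr -scalerBr RJ scalerA mxE.
by congr (_ *: _); ring.
Qed.

End BilinearExtension.

(** * Covariant derivatives and curvature in a chart *)
Section Charts.
Context {R : realType} {m : nat} {M : smooth_manifold R m}.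
Local Notation E := 'cV[R]_m.
Variables (nabla : connection M) (c : chart R m M).
Hypothesis cA : atlas c.

Definition christoffel_mx (i : 'I_m) (x : E) : 'M[R]_m :=
  \matrix_(k, j) nabla c k i j x.
Local Notation Gam := christoffel_mx.

(** [cimg c U] is the set of the points of the open image of the chart that the
    continuous map [cinv c] sends into U. *)
Lemma open_cimg (U : set M) : open U -> open (cimg c U).
Proof.
move=> oU; rewrite openE => x [p [cp Up] <-].
have N1 : nbhs (cmap c p) (cmap c @` cdom c).
  by apply: open_nbhs_nbhs; split; [exact: cimg_open|exists p].
have N2 : \forall y \near cmap c p, U (cinv c y).
  have := @cinv_continuous _ _ _ c p cp; apply.
  by rewrite cmapK //; exact: open_nbhs_nbhs.
apply: filterS2 N1 N2 => y [q cq <-] Uq; exists q => //; split=> //.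
by rewrite cmapK in Uq.
Qed.

Lemma christoffel_mx_smooth i : smooth_mx (cimg c setT) (Gam i).
Proof.
move=> k j; have -> : (fun x => Gam i x k j) = nabla c k i j.
  by apply/funext => x; rewrite mxE.
exact: conn_smooth.
Qed.

Lemma covE (X Y : E -> E) x :
  cov nabla c X Y x = \sum_i X x i 0 *: (dmx i Y x + Gam i x *m Y x).
Proof.
apply/colP => k; rewrite mxE summxE /Lie_der -big_split /=.
apply: eq_bigr => i _; rewrite !mxE mulrDr; congr (_ + _).
rewrite mulr_sumr; apply: eq_bigr => j _; rewrite mxE; ring.
Qed.

Lemma cov_coord i (Y : E -> E) x :
  cov nabla c (coord_field i) Y x = dmx i Y x + Gam i x *m Y x.
Proof.
rewrite covE (bigD1 i) //= big1 => [|k ki]; rewrite /coord_field mxE.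
  by rewrite !eqxx scale1r addr0.
by rewrite (negbTE ki) scale0r.
Qed.

End Charts.

Section ChartCurvature.
Context {R : realType} {m : nat} {M : smooth_manifold R m}.
Local Notation E := 'cV[R]_m.
Variables (nabla : connection M) (c : chart R m M).
Hypothesis cA : atlas c.
Local Notation U := (cimg c setT).
Local Notation Gam := (christoffel_mx nabla c).

Let oU : open U := open_cimg openT.

Definition curv_op (x : E) := bilinear_ext (fun i j => curv_mx Gam i j x).

(** Tensoriality of the curvature: the terms in which X or Y is differentiated
    are removed by the bracket, those in which Z is differentiated by the
    symmetry of second derivatives. *)
Lemma curvE (X Y Z : E -> E) x : U x ->
  smooth_mx U X -> smooth_mx U Y -> smooth_mx U Z ->
  curv nabla c X Y Z x = curv_op x (X x) (Y x) *m Z x.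
Proof.
move=> Ux sX sY sZ.
have dZ := smooth_mx_diff sZ Ux.
pose D k (W : E -> E) y := dmx k W y + Gam k y *m W y.
have dDZ k : differentiable_mx (D k Z) x.
  apply: differentiable_mxD; first exact: smooth_mx_diff (smooth_mx_dmx _ sZ) Ux.
  apply: differentiable_mxM => //.
  exact: smooth_mx_diff (christoffel_mx_smooth nabla cA k) Ux.
have covcov (S T : E -> E) : smooth_mx U T -> cov nabla c S (cov nabla c T Z) x =
    \sum_j (\sum_i S x i 0 * partial i (fun y => T y j 0) x) *: D j Z x
    + \sum_i \sum_j (S x i 0 * T x j 0) *: D i (D j Z) x.
  move=> sT; have dT j : differentiable (fun y => T y j 0) x.
    exact: smooth_mx_diff sT Ux _ _.
  have -> : cov nabla c T Z = fun y => \sum_j T y j 0 *: D j Z y.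
    by apply/funext => y; rewrite covE.
  rewrite covE; under [X in X + _]eq_bigr => j _ do rewrite scaler_suml.
  rewrite [X in X + _]exchange_big -big_split /=; apply: eq_bigr => i _.
  rewrite dmx_sum; last by move=> k; exact: differentiable_mxZ.
  rewrite mulmx_sumr -big_split scaler_sumr -big_split /=; apply: eq_bigr => j _.
  by rewrite dmxZ // -scalemxAr -addrA -scalerDr [LHS]scalerDr !scalerA.
rewrite /curv !covcov // covE.
have -> : \sum_i bracket X Y x i 0 *: (dmx i Z x + Gam i x *m Z x) =
    \sum_j (\sum_i X x i 0 * partial i (fun y => Y y j 0) x) *: D j Z x
    - \sum_j (\sum_i Y x i 0 * partial i (fun y => X y j 0) x) *: D j Z x.
  by rewrite -sumrB; apply: eq_bigr => j _; rewrite -scalerBl mxE.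
have -> : curv_op x (X x) (Y x) *m Z x =
    \sum_i \sum_j (X x i 0 * Y x j 0) *: D i (D j Z) x
    - \sum_i \sum_j (Y x i 0 * X x j 0) *: D i (D j Z) x.
  rewrite [X in _ - X]exchange_big -sumrB /= /curv_op mulmx_suml.
  apply: eq_bigr => i _; rewrite -sumrB mulmx_suml; apply: eq_bigr => j _.
  rewrite [Y x j 0 * _]mulrC -scalerBr -scalemxAl; congr (_ *: _).
  by rewrite (ricci_identity_vector oU (christoffel_mx_smooth nabla cA) i j Ux sZ).
set a := \sum_j _; set b := \sum_i _; set a' := \sum_j _; set b' := \sum_i _.
by apply/matrixP => p q; rewrite !mxE; ring.
Qed.

Lemma smooth_coord_field (W : set E) i : smooth_mx W (coord_field i : E -> E).
Proof. exact: smooth_mx_cst. Qed.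

Lemma curv_coordE i j k x : U x ->
  curv nabla c (coord_field i) (coord_field j) (coord_field k) x
  = curv_op x (delta_mx i 0) (delta_mx j 0) *m delta_mx k 0.
Proof. by move=> Ux; rewrite curvE //; exact: smooth_coord_field. Qed.

(** The two contractions with the inverse metric in the Ricci tensor amount to a
    trace of endomorphisms. *)
Lemma scalar_curvE (g : tensor02 M) x : U x ->
  (g c x)^T = g c x -> g c x \in unitmx ->
  scalar_curv nabla c g x = \sum_i \sum_j invmx (g c x) i j *
    ricci_form (curv_op x) (delta_mx i 0) (delta_mx j 0).
Proof.
move=> Ux gT gU; apply: eq_bigr => i _; apply: eq_bigr => j _; congr (_ * _).
apply: eq_bigr => k _; rewrite /curv4 curv_coordE //.
set u := _ *m delta_mx j 0.
have gu l : bil (g c x) u (coord_field l x) = (g c x *m u) l 0.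
  by rewrite bilC gT /bil trmx_delta -mulmxA -rowE mxE.
under eq_bigr => l _ do rewrite gu.
by rewrite -[RHS](congr1 (fun v : E => v k 0) (mulKmx gU u)) mxE.
Qed.

Variable g : tensor02 M.
Hypothesis LC : Levi_Civita g nabla.

(** Coordinate fields have vanishing brackets. *)
Lemma christoffel_mx_sym a b x : U x ->
  Gam a x *m delta_mx b 0 = Gam b x *m (delta_mx a 0 : E).
Proof.
move=> Ux.
have [+ _] := LC cA Ux (smooth_coord_field _ a) (smooth_coord_field _ b)
  (smooth_coord_field _ a).
rewrite !cov_coord !dmx_cst !add0r => /eqP; rewrite subr_eq => /eqP ->.
rewrite -[RHS]add0r; congr (_ + _); apply/colP => k; rewrite mxE /Lie_der.
by rewrite !big1 ?mxE ?subrr // => i _; rewrite partial_cst mulr0.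
Qed.

Lemma metric_parallel k x : U x ->
  dmx k (g c) x = (Gam k x)^T *m g c x + g c x *m Gam k x.
Proof.
move=> Ux; apply/matrixP => a b.
have [_] := LC cA Ux (smooth_coord_field _ k) (smooth_coord_field _ a)
  (smooth_coord_field _ b).
rewrite !cov_coord !dmx_cst !add0r /coord_field bil_mulmxl bil_mulmxr.
rewrite -bil_addmx bil_delta => <-; rewrite dmxE /Lie_der.
rewrite (bigD1 k) //= big1 => [|i ik]; rewrite mxE.
  rewrite !eqxx mul1r addr0; congr (partial _ _ _).
  by apply/funext => y; rewrite bil_delta.
by rewrite (negbTE ik) mul0r.
Qed.

End ChartCurvature.

(** * Quaternionic Kaehler structures with Norden metrics *)

(** A diagonal matrix of signs is its own inverse. *)
Lemma signature_unitmx (R : realType) m p q (g : 'M[R]_m) :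
  has_signature p q g -> g \in unitmx.
Proof.
case=> _ _ [P _ PgP].
set D := diag_mx _ in PgP.
have DD : D *m D = 1%:M.
  apply/matrixP => i j; rewrite mul_diag_mx !mxE.
  have [->|_] := eqVneq i j; rewrite ?mulr0n ?mulr0 // ?mulr1n.
  by case: ifP; rewrite ?mulrNN mulr1.
have [] := mulmx1_unit DD; rewrite -PgP => + _.
by rewrite !unitmx_mul => /andP[/andP[]].
Qed.

Section QuaternionicKahler.
Context {R : realType} {n : nat} {M : smooth_manifold R (4 * n)%N}.
Context {H : almost_hypercomplex M} {G : NH_metric H} {nabla : connection M}.
Local Notation E := 'cV[R]_(4 * n).
Local Notation g := (nh_g G).
Variable c : chart R (4 * n)%N M.
Hypothesis cA : atlas c.
Local Notation Gam := (christoffel_mx nabla c).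

Lemma hypercomplex_adjoint a x : cimg c setT x ->
  (H a c x)^T *m g c x = - eps R a *: (g c x *m H a c x).
Proof.
move=> Ux.
have ee : eps R a * eps R a = 1 by rewrite /eps; case: ifP; rewrite ?mulr1 ?mulrNN ?mulr1.
have gE : g c x = eps R a *: ((H a c x)^T *m g c x *m H a c x).
  apply: bil_mx_inj => u v; rewrite (nh_compat G a u v cA Ux) bil_scalemx.
  by rewrite bil_mulmxl bil_mulmxr.
rewrite {2}gE -scalemxAl -mulmxA (hc_sqr _ _ cA Ux) mulmxN mulmx1.
by rewrite scalerA mulNr ee scaleN1r opprK.
Qed.

Lemma cov_endo_mx (A : tensor11 M) (W : set M) x : open W -> cimg c W x ->
  forall B : 'I_(4 * n) -> 'M[R]_(4 * n),
  (forall i (Y : E -> E), smooth_mx (cimg c W) Y ->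
    cov_endo nabla c A (coord_field i) Y x = B i *m Y x) ->
  forall i, dmx i (A c) x + Gam i x *m A c x - A c x *m Gam i x = B i.
Proof.
move=> oW Wx B AB i; apply/matrixP => a b.
have Ux : cimg c setT x by case: Wx => p [cp _] <-; exists p.
have := AB i (coord_field b) (smooth_coord_field _ _).
have dA := smooth_mx_diff (t11_smooth A cA) Ux.
have de : differentiable_mx (coord_field b : E -> E) x.
  exact: smooth_mx_diff (smooth_coord_field setT b) _.
rewrite /cov_endo !cov_coord dmxM // dmx_cst mulmx0 addr0 add0r /coord_field.
rewrite !mulmxA -!mulmxDl -mulmxBl => /colP/(_ a).
by rewrite -!colE [LHS]mxE [RHS]mxE.
Qed.

Hypothesis LC : Levi_Civita g nabla.
Hypothesis QK : quaternionic_Kahler H nabla.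
Hypothesis n2 : (2 <= n)%N.

(** The connection forms other than the first one vanish because covariant
    derivatives of self-adjoint structures are self-adjoint, while I is
    skew-adjoint; what remains is the algebra of [QuaternionicCurvature]. *)
Lemma quaternionic_Kahler_curv_op_eq0 x : cimg c setT x ->
  scalar_curv nabla c g x = 0 -> forall u v, curv_op nabla c x u v = 0.
Proof.
move=> Ux tau0.
case: {+}Ux => p [cp _] px.
have [W [oW Wp [w hw]]] := QK p.
pose V := cimg c W.
have oV : open V by exact: open_cimg.
have Vx : V x by exists p.
have VU : V `<=` cimg c setT by move=> y [q [cq _] <-]; exists q.
have sG i : smooth_mx V (Gam i) by exact: smooth_mx_sub VU (christoffel_mx_smooth _ cA i).
have sH a : smooth_mx V (H a c) by exact: smooth_mx_sub VU (t11_smooth _ cA).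
have sg : smooth_mx V (g c) by exact: smooth_mx_sub VU (t02_smooth _ cA).
have gS y : V y -> has_signature (2 * n) (2 * n) (g c y).
  by move=> /VU Uy; exact: nh_neutral.
have gT y : V y -> (g c y)^T = g c y by move=> /gS[].
have gU y : V y -> g c y \in unitmx by move=> /gS/signature_unitmx.
pose I := H 0; pose J := H 1; pose K := H 2.
have e12 : (1 + 2 : 'Z_3) = 0 by apply/val_inj.
have e22 : (2 + 2 : 'Z_3) = 1 by apply/val_inj.
have e21 : (2 + 1 : 'Z_3) = 0 by apply/val_inj.
have IT y : V y -> (I c y)^T *m g c y = - (g c y *m I c y).
  by move=> /VU Uy; rewrite hypercomplex_adjoint // /eps eqxx scaleNr scale1r.
have JT y : V y -> (J c y)^T *m g c y = g c y *m J c y.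
  by move=> /VU Uy; rewrite hypercomplex_adjoint // /eps /= opprK scale1r.
have KT y : V y -> (K c y)^T *m g c y = g c y *m K c y.
  by move=> /VU Uy; rewrite hypercomplex_adjoint // /eps /= opprK scale1r.
have gP k y : V y -> dmx k (g c) y = (Gam k y)^T *m g c y + g c y *m Gam k y.
  by move=> /VU Uy; exact: metric_parallel.
pose om a k y : R := w a c y 0 k.
have omE a k y : (w a c y *m (delta_mx k 0 : E)) 0 0 = om a k y.
  by rewrite -colE mxE.
have DH a k y : V y -> dmx k (H a c) y + Gam k y *m H a c y - H a c y *m Gam k y
    = om (a + 2) k y *: H (a + 1) c y - om (a + 1) k y *: H (a + 2) c y.
  move=> Vy; move: k; apply: (cov_endo_mx oW Vy) => k Y sY.
  by rewrite (hw a c y) //; [rewrite !omE mulmxBl -!scalemxAl|exact: smooth_coord_field].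
have symZ (s : R) (A : 'M[R]_(4 * n)) y : A^T *m g c y = g c y *m A ->
    (s *: A)^T *m g c y = g c y *m (s *: A).
  by move=> gA; rewrite linearZ /= -scalemxAl gA scalemxAr.
(* a multiple of I that is both self-adjoint and skew-adjoint is zero *)
have symI0 (s : R) (S : 'M[R]_(4 * n)) y : V y -> S^T *m g c y = g c y *m S ->
    (s *: I c y + S)^T *m g c y = g c y *m (s *: I c y + S) -> s *: I c y = 0.
  move=> Vy gS'; rewrite trmx_add mulmxDl mulmxDr gS' => /addIr.
  rewrite linearZ /= -scalemxAl IT // -scalemxAr scalerN => /eqP.
  rewrite eq_sym -addr_eq0 -mulr2n -(scaler_nat 2) scaler_eq0 pnatr_eq0 /=.
  by rewrite scalemxAr => /eqP E0; rewrite -(mulKmx (gU y Vy) (s *: _)) E0 mulmx0.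
have DJ k y : V y -> dmx k (J c) y + Gam k y *m J c y - J c y *m Gam k y
    = om 0 k y *: K c y.
  move=> Vy; have D : dmx k (J c) y + Gam k y *m J c y - J c y *m Gam k y
      = - om 2 k y *: I c y + om 0 k y *: K c y.
    by rewrite (DH 1 k y Vy) e12 scaleNr [RHS]addrC.
  have := cov_self_adjoint
    (B := - om 2 k y *: I c y + om 0 k y *: K c y)
    oV Vy sg (sH 1) (gP k y Vy) D JT.
  by rewrite D => /(symI0 _ _ _ Vy (symZ _ _ _ (KT y Vy))) ->; rewrite add0r.
have DK k y : V y -> dmx k (K c) y + Gam k y *m K c y - K c y *m Gam k y
    = - (om 0 k y *: J c y).
  move=> Vy; have D : dmx k (K c) y + Gam k y *m K c y - K c y *m Gam k y
      = om 1 k y *: I c y + - om 0 k y *: J c y.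
    by rewrite (DH 2 k y Vy) e22 e21 scaleNr.
  have := cov_self_adjoint
    (B := om 1 k y *: I c y + - om 0 k y *: J c y)
    oV Vy sg (sH 2) (gP k y Vy) D KT.
  rewrite D => /(symI0 _ _ _ Vy (symZ _ _ _ (JT y Vy))) ->.
  by rewrite add0r scaleNr.
(* components of the exterior derivative of the first connection form *)
pose F : 'M[R]_(4 * n) := \matrix_(i, j) (partial i (om 0 j) x - partial j (om 0 i) x).
have dom k : differentiable (om 0 k) x.
  exact: smooth_mx_diff (t01_smooth (w 0) cA) Vx _ _.
have FT : F^T = - F by apply/matrixP => i j; rewrite !mxE opprB.
pose phi := invmx (g c x) *m F^T.
have gphi : g c x *m phi = - F by rewrite mulKVmx ?gU // FT.
have phig : phi^T *m g c x = F.
  by rewrite trmx_mul trmxK trmx_inv gT // mulmxKV ?gU.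
have phiE u v : bil (g c x) (phi *m u) v = bil F u v by rewrite bil_mulmxl phig.
have RJ i j : curv_mx Gam i j x *m J c x - J c x *m curv_mx Gam i j x = F i j *: K c x.
  rewrite mxE; have dK := smooth_mx_diff (sH 2) Vx.
  exact: (curv_mx_rotation oV sG i j Vx (sH 1) dK dom DJ DK).
have RK i j : curv_mx Gam i j x *m K c x - K c x *m curv_mx Gam i j x = F i j *: - J c x.
  rewrite mxE.
  (* the pair (K, - J) is rotated by the same form as (J, K) *)
  have dmJ y : V y -> differentiable_mx (fun z => - J c z) y.
    by move=> Vy; exact/differentiable_mxN/(smooth_mx_diff (sH 1) Vy).
  apply: (curv_mx_rotation oV sG i j Vx (sH 2) (dmJ x Vx) dom) => k y Vy.
    by rewrite DK // scalerN.
  rewrite dmxN; last exact: smooth_mx_diff (sH 1) Vy.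
  by rewrite mulmxN mulNmx -!opprD DJ.
have IJK : I c x = J c x *m K c x.
  by have := hc_mul H 0 cA Ux; rewrite !add0r.
have IKJ : I c x = - (K c x *m J c x).
  by have := hc_anti H 0 cA Ux; rewrite !add0r.
apply: (@curvature_eq0_of_scalar_eq0 _ _ (g c x) (I c x) (J c x) (K c x)
  _ _ _ _ _ _ _ _ _ _ _ _ phi).
- exact: gT.
- exact: gU.
- exact: JT.
- exact: KT.
- exact: (hc_sqr H _ cA Ux).
- exact: (hc_sqr H _ cA Ux).
- exact: IJK.
- by rewrite -IJK IKJ opprK.
- by apply: bilinear_extC => i j; exact: curv_mxC.
- apply: bilinear_ext_bianchi => i j k.
  apply: (curv_mx_bianchi oV sG i j k Vx) => a b y /VU Uy.
  exact: (christoffel_mx_sym cA LC).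
- by apply: bilinear_ext_skew => i j; exact: (curv_mx_metric oV sG i j Vx sg gP).
- by rewrite phig gphi opprK.
- move=> u v; rewrite phiE; exact: bilinear_ext_commutator.
- move=> u v; rewrite phiE scaleNr -scalerN; exact: bilinear_ext_commutator.
- by move=> u v; exact: bilinear_extE.
- by rewrite -lt0n muln_gt0 (leq_trans _ n2).
- by rewrite gtn_eqF // (leq_trans _ (leq_mul (leqnn 4) n2)).
- by rewrite -scalar_curvE ?gT ?gU.
Qed.

End QuaternionicKahler.

Theorem proposition2p8 (R : realType) (n : nat) (hn : (2 <= n)%N)
    (M : smooth_manifold R (4 * n)%N) (H : almost_hypercomplex M)
    (G : NH_metric H) (nabla : connection M)
    (hLC : Levi_Civita (nh_g G) nabla)
    (hQK : quaternionic_Kahler H nabla) :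
  scalar_flat (nh_g G) nabla <-> flat nabla.
Proof.
split=> [tau0 c x X Y Z cA Ux sX sY sZ|R0 c x cA Ux].
  rewrite (curvE nabla cA Ux sX sY sZ).
  by rewrite (quaternionic_Kahler_curv_op_eq0 cA hLC hQK hn Ux (tau0 c x cA Ux)) mul0mx.
apply: big1 => i _; apply: big1 => j _; rewrite [Ricci _ _ _ _ _ _]big1 ?mulr0 // => k _.
apply: big1 => l _; rewrite /curv4 R0 ?bil0l ?mulr0 //; exact: smooth_coord_field.
Qed.
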